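(* Let $\Gamma$ be a connected unbounded graph and let $n$ be a positive integer. If $\mathsf{wCop}(\Gamma)=1$, then $\mathsf{wCop}(\Theta_n(\Gamma))=n$. Analogously, if $\mathsf{sCop}(\Gamma)=1$, then $\mathsf{sCop}(\Theta_n(\Gamma))=n$. Here $\Theta_n(\Gamma)$ is the $\Theta_n$-extension of $\Gamma$ (centered at any vertex $u_0$ of $\Gamma$).
   Context: Graphs are undirected, without double edges and without loops. For a connected graph $\Gamma$, $\mathsf{dist}$ (or $\mathsf{dist}_\Gamma$) is the path distance on $V(\Gamma)$. A graph is unbounded if it has infinite diameter. $\Theta_n$-extension. Let $\Gamma$ be a connected graph, $u_0$ a vertex of $\Gamma$, $n$ a positive integer. Let $\Gamma_1,\dots,\Gamma_n$ be disjoint graphs with fixed isomorphisms $\eta_k\colon\Gamma\to\Gamma_k$. The $\Theta_n$-extension $\Theta_n(\Gamma)$ of $\Gamma$ centered at $u_0$ is the disjoint union $\Gamma_1\sqcup\dots\sqcup\Gamma_n$ together with, for each vertex $x$ of $\Gamma$ and each $1\le i<j\le n$, a path (called a bridge) of length $\mathsf{dist}_\Gamma(u_0,x)+1$ between $\eta_i(x)$ and $\eta_j(x)$. Formally, with $l=\mathsf{dist}_\Gamma(u_0,x)$, one adds $l$ new vertices $x^{i,j}_1,\dots,x^{i,j}_l$ and the edges $\{\eta_i(x),x^{i,j}_1\},\{x^{i,j}_1,x^{i,j}_2\},\dots,\{x^{i,j}_l,\eta_j(x)\}$ (the single edge $\{\eta_i(x),\eta_j(x)\}$ if $l=0$); new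 vertices for different triples $(i,j,x)$ are distinct. Game. The cops and robber game on a connected graph $\Gamma$ has parameters: number of cops $n$, cop speed $\sigma$, cop reach $\rho$, robber speed $\psi$, a vertex $v$, and a positive integer $R$. It is a perfect information game. First the $n$ cops choose initial vertices $c^1_0,\dots,c^n_0$; then, knowing these, the robber chooses an initial vertex $r_0$. In stage $k\ge 1$ each cop moves from $c^i_{k-1}$ to a vertex $c^i_k$ with $\mathsf{dist}(c^i_{k-1},c^i_k)\le\sigma$. The robber is captured during stage $k$ if $\mathsf{dist}(r_{k-1},c^i_k)\le\rho$ for some $i$. If not captured, the robber moves from $r_{k-1}$ to a vertex $r_k$ such that there is a path from $r_{k-1}$ to $r_k$ of length at most $\psi$ all of whose vertices are at distance larger than $\rho$ from every $c^i_k$. The cops win (protect the $R$-ball centered at $v$) if the robber is captured at some stage or there is $N>0$ such that $\mathsf{dist}(v,r_k)>R$ for all $k\ge N$. $\Gamma$ is $\mathsf{CopWin}(n,\sigma,\rho,\psi,R)$ if for every vertex $v$ of $\Gamma$ the $n$ cops have a winning strategy in the game with parameters $n,\sigma,\rho,\psi,v,R$. $\Gamma$ is $n$-weak cop win if $\exists\,\sigma\in\mathbb{Z}_{>0}\ \exists\,\rho\in\mathbb{Z}_{\ge0}\ \forall\,\psi,R\in\mathbb{Z}_{>0}$: $\Gamma$ is $\mathsf{CopWin}(n,\sigma,\rho,\psi,R)$. $\Gamma$ is $n$-strong cop win if $\exists\,\sigma\in\mathbb{Z}_{>0}\ \forall\,\psi\in\mathbb{Z}_{>0}\ \exists\,\rho\in\mathbb{Z}_{\ge0}\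 \forall\,R\in\mathbb{Z}_{>0}$: $\Gamma$ is $\mathsf{CopWin}(n,\sigma,\rho,\psi,R)$. The weak cop number $\mathsf{wCop}(\Gamma)$ (resp. strong cop number $\mathsf{sCop}(\Gamma)$) in $\mathbb{Z}_{>0}\cup\{\infty\}$ is the smallest positive integer $n$ such that $\Gamma$ is $n$-weak (resp. $n$-strong) cop win, and $\infty$ if there is none. *)

(* Defs.v *)
From mathcomp Require Import all_boot.
From mathcomp Require Import boolp.

Set Implicit Arguments.
Unset Strict Implicit.
Unset Printing Implicit Defensive.

(* Simple graphs on an arbitrary, possibly infinite, vertex type. *)
Record sgraph := SGraph {
  vertex :> Type;
  edge : rel vertex;
  edge_sym : symmetric edge;
  edge_irrefl : irreflexive edge
}.

Section Distance.
Variable G : sgraph.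

(* The path runs through x :: p, so its length is size p; vertices may be
   repeated, which changes neither distances nor the moves of the game. *)
Definition is_path (x y : G) (p : seq G) : Prop :=
  path (@edge G) x p /\ last x p = y.

Definition path_of_length (x y : G) (k : nat) : Prop :=
  exists2 p, is_path x y p & size p = k.

(* Junk value 0 if x and y lie in different components. *)
Definition dist (x y : G) : nat :=
  if pselect (exists k, `[< path_of_length x y k >]) is left h
  then ex_minn h else 0.

Definition connected : Prop := forall x y : G, exists p, is_path x y p.

Definition unbounded : Prop := forall D : nat, exists x y : G, D < dist x y.

End Distance.

Section Game.
Variables (G : sgraph) (n : nat).

Definition cops := 'I_n -> G.

(* The next positions of the cops, given the list
   [:: (c_0, r_0); ...; (c_(k-1), r_(k-1))] of all earlier positions. *)
Definition cop_strategy := seq (cops * G) -> cops.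

Variables (sigma rho psi : nat).

Definition cop_move (c c' : cops) : Prop :=
  forall i, dist (c i) (c' i) <= sigma.

(* Stages are numbered from 1: this is capture during stage k.+1. *)
Definition captured (c : nat -> cops) (r : nat -> G) (k : nat) : Prop :=
  exists i, dist (r k) (c k.+1 i) <= rho.

Definition robber_move (c : cops) (x y : G) : Prop :=
  exists p : seq G, [/\ is_path x y p, size p <= psi &
    all (fun w => [forall i, rho < dist w (c i)]) (x :: p)].

(* A capture ends the game; the sequences are unconstrained afterwards. *)
Definition robber_legal (c : nat -> cops) (r : nat -> G) : Prop :=
  forall k, (forall j, j <= k -> ~ captured c r j) ->
    robber_move (c k.+1) (r k) (r k.+1).

Definition cops_legal (c : nat -> cops) (r : nat -> G) : Prop :=
  forall k, (forall j, j < k -> ~ captured c r j) -> cop_move (c k) (c k.+1).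

Definition follows (S : cop_strategy) (c : nat -> cops) (r : nat -> G) : Prop :=
  forall k, c k = S (mkseq (fun j => (c j, r j)) k).

Definition cops_win (v : G) (R : nat) (c : nat -> cops) (r : nat -> G) : Prop :=
  (exists k, captured c r k) \/
  (exists2 N, 0 < N & forall k, N <= k -> R < dist v (r k)).

(* An uncaptured robber may always stay in place, so every finite legal play
   extends to an infinite one, and it is enough to consider the latter. *)
Definition winning_strategy (v : G) (R : nat) (S : cop_strategy) : Prop :=
  forall c r, follows S c r -> robber_legal c r ->
    cops_legal c r /\ cops_win v R c r.

End Game.

Definition CopWin (G : sgraph) (n sigma rho psi R : nat) : Prop :=
  forall v : G, exists S : cop_strategy G n, winning_strategy sigma rho psi v R S.

Definition weak_cop_win (G : sgraph) (n : nat) : Prop :=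
  exists2 sigma, 0 < sigma & exists rho, forall psi R,
    0 < psi -> 0 < R -> CopWin G n sigma rho psi R.

Definition strong_cop_win (G : sgraph) (n : nat) : Prop :=
  exists2 sigma, 0 < sigma & forall psi, 0 < psi -> exists rho, forall R,
    0 < R -> CopWin G n sigma rho psi R.

(* None stands for infinity. *)
Definition least_positive (P : nat -> Prop) : option nat :=
  if pselect (exists m, `[< 0 < m /\ P m >]) is left h
  then Some (ex_minn h) else None.

Definition wCop (G : sgraph) : option nat := least_positive (weak_cop_win G).

Definition sCop (G : sgraph) : option nat := least_positive (strong_cop_win G).

Section Theta.
Variables (n : nat) (G : sgraph) (u0 : G).

(* InCopy k x is eta_k(x); OnBridge i j _ x m _ is x^{i,j}_m. *)
Inductive theta_vertex : Type :=
| InCopy (k : 'I_n) (x : G)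
| OnBridge (i j : 'I_n) (ltij : i < j) (x : G) (m : nat)
    (hm : 0 < m <= dist u0 x).

Inductive theta_step : theta_vertex -> theta_vertex -> Prop :=
| StepCopy k x y : edge x y -> theta_step (InCopy k x) (InCopy k y)
| StepDirect (i j : 'I_n) x : i < j -> dist u0 x = 0 ->
    theta_step (InCopy i x) (InCopy j x)
| StepFirst (i j : 'I_n) (ltij : i < j) x (hm : 0 < 1 <= dist u0 x) :
    theta_step (InCopy i x) (OnBridge ltij hm)
| StepInner (i j : 'I_n) (ltij : i < j) x m (hm : 0 < m <= dist u0 x)
    (hm' : 0 < m.+1 <= dist u0 x) :
    theta_step (OnBridge ltij hm) (OnBridge ltij hm')
| StepLast (i j : 'I_n) (ltij : i < j) x m (hm : 0 < m <= dist u0 x) :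
    m = dist u0 x -> theta_step (OnBridge ltij hm) (InCopy j x).

Definition theta_edge : rel theta_vertex :=
  fun a b => `[< theta_step a b \/ theta_step b a >].

Lemma theta_edge_sym : symmetric theta_edge.
Proof. by move=> a b; apply: asbool_equiv_eq; split=> -[]; [right|left|right|left]. Qed.

Lemma theta_step_neq a b : theta_step a b -> a <> b.
Proof.
case=> //.
- by move=> k x y xy [eq_xy]; rewrite eq_xy edge_irrefl in xy.
- by move=> i j x ltij _ [eq_ij]; rewrite eq_ij ltnn in ltij.
- by move=> i j ltij x m hm hm' [/n_Sn].
Qed.

Lemma theta_edge_irrefl : irreflexive theta_edge.
Proof. by move=> a; apply/asboolP => -[] /theta_step_neq. Qed.

Definition Theta : sgraph := SGraph theta_edge_sym theta_edge_irrefl.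

End Theta.

Arguments Theta n {G} u0.

(* Main.v *)
Require Import Defs.
From mathcomp Require Import all_boot.
From mathcomp Require Import boolp zify.

Set Implicit Arguments.
Unset Strict Implicit.
Unset Printing Implicit Defensive.

(** Write [|x|] for [dist u0 x]. Two facts are proved: [n] cops do as well on
    [Theta n u0] as one cop does on [G], and fewer than [n] cops are not even
    strong cop win when [G] is unbounded. Weak cop win implies strong cop win,
    so the second fact gives the lower bound for both cop numbers.

    Upper bound ([Theta_CopWin]). Collapsing bridges maps [Theta n u0] onto [G]
    without increasing distances; the image of the robber is his shadow. The
    cops play the winning strategy of one cop of [G] against the shadow, each
    in a copy of its own. Avoiding all these mirrored cops, the robber's moves
    cast a legal shadow. If the shadow stays away from the centre of the
    protected ball, so does the robber. If the shadow is captured, some cop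
    stands within reach of the shadow in every copy, so an uncaptured robber is
    inside a bridge and cannot leave it: both of its ends are covered. One of
    the two cops at the ends then walks through the bridge, pushing the robber
    towards the other one ([confined_edge]).

    Lower bound ([Theta_not_strong_cop_win]). Take [x0] with [L = |x0|] huge
    compared to the reach [rho], which may depend on the robber's speed. The
    robber lives at the [n] homes [copy k x0], pairwise more than [L] apart.
    When a cop comes close to his home [k], fewer than [n] cops cannot be close
    to all homes, so some home [j] is free, and he flees to it. There are [n]
    routes from [k] to [j]: the bridge over [x0], the detours through the home
    of any third copy, and the descent along a geodesic to [u0], across and up
    again. Away from both ends these routes are far from each other, so a cop
    threatens at most one of them and an unthreatened one exists
    ([exists_free_route]). With a speed much larger than [sigma] (but
    independent of [rho]) he arrives before the cops have moved by more than a
    small fraction of [L]; this repeats forever inside a fixed ball.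

    All distance estimates come from functions which vary by at most one along
    edges ([lipschitz]); the essential one is [depth]. *)

(** * Distances and walks *)

Section DistanceTheory.
Variable G : sgraph.
Implicit Types (x y z : G) (p : seq G) (w : nat -> G).

Lemma dist_le_path x y p : is_path x y p -> dist x y <= size p.
Proof.
move=> xy; rewrite /dist; case: pselect => // h.
by case: ex_minnP => m _; apply; apply/asboolP; exists p.
Qed.

Lemma distxx x : dist x x = 0.
Proof. by apply/eqP; rewrite -leqn0 (@dist_le_path x x [::]). Qed.

Lemma path_invariant (T : G -> Prop) (A : pred G) x p :
    (forall y z, edge y z -> A z -> T y -> T z) ->
  T x -> path (@edge G) x p -> all A p -> T (last x p).
Proof.
move=> step; elim: p x => //= y p IHp x Tx /andP[xy yp] /andP[Ay Ap].
by apply: IHp => //; apply: step xy Ay Tx.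
Qed.

(** Walks that may pause are closed under restriction, concatenation and
    extension by a constant, which paths of a prescribed length are not. *)
Definition lazy_walk w :=
  forall t, w t.+1 = w t \/ edge (w t) (w t.+1).

Lemma path_of_lazy_walk w s d : lazy_walk w ->
  exists p, [/\ is_path (w s) (w (s + d)) p, size p <= d &
    forall A : pred G, (forall t, A (w t)) -> all A (w s :: p)].
Proof.
move=> ww; elim: d => [|d [p [[wp lp] sp Ap]]].
  exists [::]; split; rewrite ?addn0 //= => A Aw.
  by rewrite Aw.
rewrite addnS; have [->|e] := ww (s + d).
  by exists p; split=> //; apply: leqW.
exists (rcons p (w (s + d).+1)); split.
- by split; rewrite ?last_rcons // rcons_path wp lp.
- by rewrite size_rcons.
- by move=> A Aw; rewrite -rcons_cons all_rcons Aw Ap.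
Qed.

Lemma dist_lazy_walk w s d : lazy_walk w -> dist (w s) (w (s + d)) <= d.
Proof.
move=> /path_of_lazy_walk-/(_ s d)[p [xy sp _]].
exact: leq_trans (dist_le_path xy) sp.
Qed.

Lemma lazy_walk_shift w s : lazy_walk w -> lazy_walk (fun t => w (s + t)).
Proof. by move=> ww t; rewrite addnS. Qed.

Lemma lazy_walk_cat w1 w2 l : lazy_walk w1 -> lazy_walk w2 -> w1 l = w2 0 ->
  lazy_walk (fun t => if t < l then w1 t else w2 (t - l)).
Proof.
move=> ww1 ww2 w12 t; case: (ltngtP t.+1 l) => [lt|lt|eq].
- exact: ww1.
- by rewrite subSn.
- by rewrite eq subnn -w12 -eq.
Qed.

Lemma lazy_walk_rev w l : lazy_walk w -> lazy_walk (fun t => w (l - t)).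
Proof.
move=> ww t; have [le|lt] := leqP l t.
  by left; congr w; lia.
rewrite (_ : l - t = (l - t.+1).+1); last by lia.
by case: (ww (l - t.+1)) => [->|]; [left | rewrite edge_sym; right].
Qed.

Variable Gconn : connected G.

Lemma geodesicP x y : exists p, is_path x y p /\ size p = dist x y.
Proof.
rewrite /dist; case: pselect => [h|[]].
  by case: ex_minnP => m /asboolP[p xy sp] _; exists p.
by have [p xy] := Gconn x y; exists (size p); apply/asboolP; exists p.
Qed.

Lemma lazy_geodesic x y : exists w, [/\ lazy_walk w, w 0 = x &
  forall t, dist x y <= t -> w t = y].
Proof.
have [p [[xp lp] <-]] := geodesicP x y.
have const t : size p <= t -> nth y (x :: p) t = y.
  rewrite leq_eqVlt => /predU1P[<-|lt]; first by rewrite -last_nth.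
  by rewrite nth_default.
exists (nth y (x :: p)); split=> // t.
case: (ltnP t (size p)) => [lt|le]; last by left; rewrite !const // leqW.
by right; apply: (pathP y xp).
Qed.

(** Lower bounds on distances are obtained from this by a check on edges. *)
Lemma lipschitz (f : G -> nat) x y :
  (forall a b : G, edge a b -> f a <= (f b).+1) -> f x <= f y + dist x y.
Proof.
move=> fL; have [p [[xp <-] <-]] := geodesicP x y.
elim: p x xp => [|z p IHp] x /=; first by rewrite addn0.
by case/andP=> /fL le /IHp; lia.
Qed.

Lemma dist_edge x y : edge x y -> dist x y <= 1.
Proof.
by move=> xy; apply: (@dist_le_path _ _ [:: y]); split=> //=; rewrite xy.
Qed.

Lemma dist_sym x y : dist x y = dist y x.
Proof.
suff le (a b : G) : dist a b <= dist b a by apply/eqP; rewrite eqn_leq !le.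
have [w [ww w0 wd]] := lazy_geodesic b a.
have := dist_lazy_walk 0 (dist b a) (lazy_walk_rev (dist b a) ww).
by rewrite subn0 wd // subnn w0.
Qed.

Lemma dist_triangle x y z : dist x z <= dist x y + dist y z.
Proof.
have [p [[xp lp] <-]] := geodesicP x y.
have [q [[yq lq] <-]] := geodesicP y z.
rewrite -size_cat; apply: dist_le_path; split.
  by rewrite cat_path xp lp.
by rewrite last_cat lp.
Qed.

End DistanceTheory.

Lemma lazy_walk_is_path (H : sgraph) (w : nat -> H) s d : lazy_walk w ->
  exists p, is_path (w s) (w (s + d)) p.
Proof. by move/path_of_lazy_walk => /(_ s d)[p []]; exists p. Qed.

Lemma is_path_cat (H : sgraph) (x y z : H) :
  (exists p, is_path x y p) -> (exists p, is_path y z p) ->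
  exists p, is_path x z p.
Proof.
move=> [p [xp <-]] [q [yq <-]]; exists (p ++ q).
by split; rewrite ?last_cat // cat_path xp.
Qed.

(** * Strategies *)

Lemma least_positiveP (P : nat -> Prop) n : 0 < n ->
  least_positive P = Some n <-> P n /\ forall m, 0 < m < n -> ~ P m.
Proof.
move=> n_gt0; rewrite /least_positive; split.
  case: pselect => // h; case: ex_minnP => k /asboolP[k_gt0 Pk] kmin [<-].
  split=> // m /andP[m_gt0 ltmk] Pm.
  suff /kmin : `[< 0 < m /\ P m >] by rewrite leqNgt ltmk.
  exact/asboolP.
case=> Pn nmin; have Pn' : `[< 0 < n /\ P n >] by apply/asboolP.
case: pselect => [h|[]]; last by exists n.
case: ex_minnP => k /asboolP[k_gt0 Pk] /(_ n Pn'); rewrite leq_eqVlt.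
case/predU1P=> [->//|ltkn]; case: (nmin k) => //.
by rewrite k_gt0.
Qed.

Lemma weak_strong_cop_win G n : weak_cop_win G n -> strong_cop_win G n.
Proof.
move=> [sigma sigma_gt0 [rho win]]; exists sigma => // psi psi_gt0.
by exists rho => R R_gt0; apply: win.
Qed.

(** Against a given strategy a play is determined by the positions of the
    robber alone. *)
Section Plays.
Variables (G : sgraph) (n : nat).

Fixpoint history (S : cop_strategy G n) (r : nat -> G) k :=
  if k is k'.+1 then
    rcons (history S r k') (S (history S r k'), r k') else [::].

Definition play S r k := S (history S r k).

Lemma historyE S r k : history S r k = mkseq (fun j => (play S r j, r j)) k.
Proof. by elim: k => //= k IHk; rewrite mkseqS -/(play S r k) -IHk. Qed.

Lemma follows_play S r : follows S (play S r) r.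
Proof. by move=> k; rewrite -historyE. Qed.

End Plays.

(** A strategy given by a memory state, updated with each position of the
    robber, is easier to reason about than a function of the whole history. *)
Section MemoryStrategies.
Variables (H : sgraph) (m : nat) (Q : Type) (q0 : Q).
Variables (update : Q -> H -> Q) (position : Q -> cops H m).

Definition memory_strategy : cop_strategy H m :=
  fun h => position (foldl (fun q cr => update q cr.2) q0 h).

Fixpoint memory (r : nat -> H) k :=
  if k is k'.+1 then update (memory r k') (r k') else q0.

Lemma memory_strategyE c r k :
  follows memory_strategy c r -> c k = position (memory r k).
Proof.
move=> ->; congr position; elim: k => // k IHk.
by rewrite mkseqS foldl_rcons IHk.
Qed.

End MemoryStrategies.

(** The robber wins if he can maintain an invariant. The cops are known to move
    legally only after the robber's whole sequence of moves has been found
    legal, so he needs an answer to illegal cop moves as well: staying where he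
    is. *)
Lemma robber_evades (H : sgraph) m sigma rho psi R (v : H)
    (I : cops H m -> H -> Prop) :
    (forall c, exists x, I c x) ->
    (forall c x, I c x -> dist v x <= R) ->
    (forall c x c', I c x -> cop_move sigma c c' ->
      (forall i, rho < dist x (c' i)) /\
      exists x', robber_move rho psi c' x x' /\ I c' x') ->
  forall S : cop_strategy H m, ~ winning_strategy sigma rho psi v R S.
Proof.
move=> Iinit Inear Istep S Swin.
have [init initI] := choice Iinit.
have /choice[next nextI] : forall a : cops H m * H * cops H m, exists x',
    if `[< I a.1.1 a.1.2 /\ cop_move sigma a.1.1 a.2 >]
    then robber_move rho psi a.2 a.1.2 x' /\ I a.2 x' else x' = a.1.2.
  move=> [[c x] c'] /=; case: asboolP => [[Icx cc']|_]; last by exists x.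
  by have [_] := Istep _ _ _ Icx cc'.
pose step (hx : seq (cops H m * H) * H) :=
  let h' := rcons hx.1 (S hx.1, hx.2) in (h', next (S hx.1, hx.2, S h')).
pose run k := iter k step ([::], init (S [::])).
pose c k := S (run k).1; pose r k := (run k).2.
have hist k : (run k).1 = mkseq (fun j => (c j, r j)) k.
  by elim: k => // k IHk; rewrite mkseqS -IHk.
have rS k : r k.+1 = next (c k, r k, c k.+1) by [].
have Sc : follows S c r by move=> k; rewrite /c hist.
have rlegal : robber_legal rho psi c r.
  move=> k free; rewrite rS; have /= := nextI (c k, r k, c k.+1).
  case: asboolP => [_ []//|_ ->]; exists [::]; split=> //=; rewrite andbT.
  apply/forallP => i; rewrite ltnNge; apply/negP => caught.
  by apply: (free k (leqnn k)); exists i.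
have [clegal cwin] := Swin c r Sc rlegal.
have inv k : I (c k) (r k) /\ forall j, j < k -> ~ captured rho c r j.
  elim: k => [|k [Ik free]]; first by split=> //; apply: initI.
  have ck := clegal k free; have [far _] := Istep _ _ _ Ik ck.
  split.
    have /= := nextI (c k, r k, c k.+1).
    by case: asboolP => [_ []//|[]].
  move=> j; rewrite ltnS leq_eqVlt => /predU1P[->|/free//] [i].
  by rewrite leqNgt far.
case: cwin => [[k]|[N _ /(_ N (leqnn N))]].
  by have [_] := inv k.+1; apply.
by have [/Inear] := inv N; rewrite ltnNge => ->.
Qed.

(** * Geometry of the extension *)

Section ThetaGeometry.
Variables (n : nat) (G : sgraph) (u0 : G) (Gconn : connected G).
Notation T := (Theta n u0).
Implicit Types (i j k : 'I_n) (x y : G) (z : T).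

Definition copy k x : T := InCopy u0 k x.

Definition shadow z : G :=
  match z with InCopy _ x => x | OnBridge _ _ _ x _ _ => x end.

(** Bridge vertices carry proofs, so equalities between them are handled
    through their coordinates. *)
Definition bridge_coord z : option ('I_n * 'I_n * G * nat) :=
  match z with
  | InCopy _ _ => None
  | OnBridge i j _ x m _ => Some (i, j, x, m)
  end.

(** The bridge over [x] with both ends included, as a walk staying at its far
    end once it is there. *)
Definition bridge_at i j (ltij : i < j) x m : T :=
  match pselect (0 < m <= dist u0 x) with
  | left hm => OnBridge ltij hm
  | right _ => if m == 0 then copy i x else copy j x
  end.

Lemma bridge_at_in i j (ltij : i < j) x m (hm : 0 < m <= dist u0 x) :
  bridge_at ltij x m = OnBridge ltij hm.
Proof.
rewrite /bridge_at; case: (pselect _) => [hm'|//].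
by rewrite (bool_irrelevance hm' hm).
Qed.

Lemma bridge_at_out i j (ltij : i < j) x m : ~~ (0 < m <= dist u0 x) ->
  bridge_at ltij x m = if m == 0 then copy i x else copy j x.
Proof. by move/negP=> out; rewrite /bridge_at; case: (pselect _). Qed.

Lemma bridge_coordP i j (ltij : i < j) x m z :
  bridge_coord z = Some (i, j, x, m) -> bridge_at ltij x m = z.
Proof.
case: z => //= i' j' lt' x' m' hm' [ei ej ex em].
move: lt' hm'; rewrite ei ej ex em => lt' hm'.
by rewrite (bool_irrelevance lt' ltij) -bridge_at_in.
Qed.

Lemma theta_edgeE (a b : T) :
  edge a b <-> theta_step a b \/ theta_step b a.
Proof. by split=> /asboolP. Qed.

Lemma edge_copy k x y : edge x y -> edge (copy k x) (copy k y).
Proof. by move=> xy; apply/theta_edgeE; left; constructor. Qed.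

Lemma edge_centre i j : i != j -> edge (copy i u0) (copy j u0).
Proof.
rewrite -val_eqE neq_ltn => /orP[lt|lt]; apply/theta_edgeE; [left|right];
  by constructor; rewrite ?distxx.
Qed.

Lemma lazy_walk_bridge i j (ltij : i < j) x : lazy_walk (bridge_at ltij x).
Proof.
move=> m; case: (boolP (0 < m <= dist u0 x)) => hm.
  right; rewrite bridge_at_in; apply/theta_edgeE.
  case: (boolP (0 < m.+1 <= dist u0 x)) => hm'.
    by left; rewrite bridge_at_in; constructor.
  by rewrite bridge_at_out //=; left; constructor; lia.
rewrite (bridge_at_out _ hm); have [m0|m_gt0] := eqVneq m 0; last first.
  by left; rewrite bridge_at_out //; lia.
right; case: (boolP (0 < m.+1 <= dist u0 x)) => hm'.
  rewrite bridge_at_in {hm}; move: hm'; rewrite m0 => hm'.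
  by apply/theta_edgeE; left; constructor.
by rewrite bridge_at_out //=; apply/theta_edgeE; left; constructor=> //; lia.
Qed.

Lemma lazy_walk_copy k w : lazy_walk w -> lazy_walk (fun t => copy k (w t)).
Proof.
move=> ww t; case: (ww t) => [->|e]; first by left.
by right; apply: edge_copy.
Qed.

Lemma bridge_at0 i j (ltij : i < j) x : bridge_at ltij x 0 = copy i x.
Proof. by rewrite bridge_at_out. Qed.

Lemma bridge_at_end i j (ltij : i < j) x m : dist u0 x < m ->
  bridge_at ltij x m = copy j x.
Proof. by move=> lt; rewrite bridge_at_out; [case: m lt | lia]. Qed.

Lemma is_path_copy k x y : exists p, is_path (copy k x) (copy k y) p.
Proof.
have [w [ww w0 wy]] := lazy_geodesic Gconn x y.
have := lazy_walk_is_path 0 (dist x y) (lazy_walk_copy k ww).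
by rewrite add0n w0 wy.
Qed.

Lemma Theta_connected : connected T.
Proof.
have from_copy k x z : exists p, is_path (copy k x) z p.
  case: z => [j y|i j ltij y m hm].
    apply: is_path_cat (is_path_copy k x u0) _.
    apply: is_path_cat (is_path_copy j u0 y).
    have [->|ne] := eqVneq k j; first by exists [::].
    by exists [:: copy j u0]; split=> //=; rewrite andbT; apply: edge_centre.
  apply: (@is_path_cat _ _ (copy i y)).
    apply: is_path_cat (is_path_copy k x u0) _.
    apply: is_path_cat (is_path_copy i u0 y).
    have [->|ne] := eqVneq k i; first by exists [::].
    by exists [:: copy i u0]; split=> //=; rewrite andbT; apply: edge_centre.
  have := lazy_walk_is_path 0 m (lazy_walk_bridge ltij y).
  by rewrite add0n bridge_at0 bridge_at_in.
move=> a b; case: a => [k x|i j ltij x m hm]; first exact: from_copy.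
apply: is_path_cat (from_copy j x b).
have := lazy_walk_is_path m (dist u0 x).+1 (lazy_walk_bridge ltij x).
by rewrite bridge_at_in bridge_at_end //; lia.
Qed.

Lemma dist_copy k x y : dist (copy k x) (copy k y) <= dist x y.
Proof.
have [w [ww w0 wy]] := lazy_geodesic Gconn x y.
have := dist_lazy_walk 0 (dist x y) (lazy_walk_copy k ww).
by rewrite add0n w0 wy.
Qed.

Lemma edge_shadow (a b : T) : edge a b -> shadow a = shadow b \/
  exists k, [/\ a = copy k (shadow a), b = copy k (shadow b) &
    edge (shadow a) (shadow b)].
Proof.
move=> /theta_edgeE[] [] /=; try by left.
- by move=> k x y xy; right; exists k.
- by move=> k x y xy; right; exists k; split=> //; rewrite edge_sym.
Qed.

Lemma dist_shadow (a b : T) : dist (shadow a) (shadow b) <= dist a b.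
Proof.
have := @lipschitz _ Theta_connected (fun z => dist (shadow z) (shadow b)) a b.
rewrite distxx; apply=> {}a c /edge_shadow[->//|[k [_ _ e]]].
have := dist_triangle Gconn (shadow a) (shadow c) (shadow b).
by have := dist_edge e; lia.
Qed.

(** The territory of copy [i] consists of that copy and of the bridges leaving
    it. Inside it, [depth i] is the distance to the nearest other copy; this is
    [|x|.+1] at [copy i x], because walking first to some [y] in order to use a
    shorter bridge costs [dist x y], which is at least [|x| - |y|]. *)
Definition depth i z : nat :=
  match z with
  | InCopy k x => if k == i then (dist u0 x).+1 else 0
  | OnBridge a b _ x m _ =>
      if a == i then (dist u0 x).+1 - m else if b == i then m else 0
  end.

Lemma depth_edge i (a b : T) : edge a b -> depth i a <= (depth i b).+1.
Proof.
have step (c d : T) : theta_step c d ->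
    depth i c <= (depth i d).+1 /\ depth i d <= (depth i c).+1.
  case=> /=.
  - move=> k x y xy; case: ifP => // _.
    have := dist_triangle Gconn u0 x y; have := dist_triangle Gconn u0 y x.
    rewrite (dist_sym Gconn y x); have := dist_edge xy; lia.
  - by move=> k j x lt ->; do 2 case: ifP => _; lia.
  - move=> k j lt x hm; case: ifP => [_|_]; first by lia.
    by case: ifP; lia.
  - move=> k j lt x m hm hm'; case: ifP => [_|_]; first by lia.
    by case: ifP; lia.
  - move=> k j lt x m hm em; case: (eqVneq k i) => [ki|_].
      by case: (eqVneq j i) => [ji|_]; [move: lt; rewrite ki ji ltnn | lia].
    by case: ifP; lia.
by move=> /theta_edgeE[] /step; lia.
Qed.

Lemma depth_lipschitz i (a b : T) : depth i a <= depth i b + dist a b.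
Proof. apply: lipschitz; [exact: Theta_connected | exact: depth_edge]. Qed.

(** On the bridge from [copy i x] to [copy j x] the two depths bound the
    distances to the opposite ends. *)
Lemma exists_bridge i j x : i != j -> exists w : nat -> T,
  [/\ lazy_walk w, w 0 = copy i x, forall t, dist u0 x < t -> w t = copy j x &
    forall t, [/\ dist (w t) (copy j x) <= depth i (w t),
      dist (w t) (copy i x) <= depth j (w t) &
      forall a, a != i -> a != j -> depth a (w t) = 0]].
Proof.
(* The depths are in fact the numbers of steps left and done. *)
suff main : i != j -> exists w : nat -> T,
  [/\ lazy_walk w, w 0 = copy i x, forall t, dist u0 x < t -> w t = copy j x &
    forall t, [/\ depth i (w t) = (dist u0 x).+1 - t,
      depth j (w t) = minn t (dist u0 x).+1 &
      forall a, a != i -> a != j -> depth a (w t) = 0]].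
  move=> /main[w [ww w0 we wd]]; exists w; split=> // t.
  have [-> -> ?] := wd t; split=> //.
    have [le|lt] := leqP t (dist u0 x).+1; last first.
      by rewrite (we t (ltnW lt)) distxx.
    have := dist_lazy_walk t ((dist u0 x).+1 - t) ww.
    by rewrite subnKC // (we _ (ltnSn _)).
  have far d : dist (copy i x) (w d) <= d.
    by have := dist_lazy_walk 0 d ww; rewrite w0.
  rewrite (dist_sym Theta_connected) leq_min far /=.
  have [le|lt] := leqP t (dist u0 x).+1; first exact: leq_trans (far t) le.
  by rewrite (we t (ltnW lt)) -(we _ (ltnSn _)) far.
have depth_l (a b : 'I_n) (ltab : a < b) t :
    depth a (bridge_at ltab x t) = (dist u0 x).+1 - t.
  have neba : (b == a) = false by rewrite -val_eqE /= gtn_eqF.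
  case: (boolP (0 < t <= dist u0 x)) => ht.
    by rewrite bridge_at_in /= eqxx.
  rewrite bridge_at_out //; case: eqP => [->|] /=; first by rewrite eqxx.
  by rewrite neba; lia.
have depth_r (a b : 'I_n) (ltab : a < b) t :
    depth b (bridge_at ltab x t) = minn t (dist u0 x).+1.
  have neab : (a == b) = false by rewrite -val_eqE /= ltn_eqF.
  case: (boolP (0 < t <= dist u0 x)) => ht.
    by rewrite bridge_at_in /= neab eqxx; lia.
  rewrite bridge_at_out //; case: eqP => [->|] /=; first by rewrite neab min0n.
  by rewrite eqxx; lia.
have depth_o (a b c : 'I_n) (ltab : a < b) t : c != a -> c != b ->
    depth c (bridge_at ltab x t) = 0.
  rewrite 2!(eq_sym c) => /negPf nca /negPf ncb.
  case: (boolP (0 < t <= dist u0 x)) => ht.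
    by rewrite bridge_at_in /= nca ncb.
  by rewrite bridge_at_out //; case: eqP => _ /=; rewrite ?nca ?ncb.
(* Bridges are oriented from the smaller copy to the larger one. *)
rewrite -val_eqE neq_ltn => /orP[lt|lt].
  exists (bridge_at lt x); split=> [|||t].
  - exact: lazy_walk_bridge.
  - exact: bridge_at0.
  - by move=> t; apply: bridge_at_end.
  - by split=> // a; apply: depth_o.
exists (fun t => bridge_at lt x ((dist u0 x).+1 - t)); split=> [||t ht|t].
- exact/lazy_walk_rev/lazy_walk_bridge.
- exact: bridge_at_end.
- by rewrite (_ : _ - t = 0) ?bridge_at0 //; lia.
- split; [by rewrite depth_r; lia | by rewrite depth_l; lia |].
  by move=> a *; apply: depth_o.
Qed.

End ThetaGeometry.

(** * As many cops as copies suffice *)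

Section Trap.
Variables (n : nat) (G : sgraph) (u0 : G) (Gconn : connected G).
Notation T := (Theta n u0).
Variables (rho : nat) (geo : G -> G -> nat -> G).
Implicit Types (i j k : 'I_n) (c x y : G) (z : T).

Definition geodesic_choice := forall x y,
  [/\ lazy_walk (geo x y), geo x y 0 = x &
    forall t, dist x y <= t -> geo x y t = y].

Let Tconn : connected T := @Theta_connected n G u0 Gconn.

Definition hunter c i j (ltij : i < j) x t : T :=
  if t < dist c x then copy u0 i (geo c x t)
  else bridge_at u0 ltij x (t - dist c x).

Definition hunt c z t : cops T n := fun a =>
  match z with
  | InCopy _ _ => copy u0 a c
  | OnBridge i j ltij x _ _ =>
      if a == i then hunter c ltij x t else copy u0 a c
  end.

Lemma lazy_walk_hunter c i j (ltij : i < j) x :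
  geodesic_choice -> lazy_walk (hunter c ltij x).
Proof.
move=> geoP; have [ww w0 we] := geoP c x; apply: lazy_walk_cat.
- exact: lazy_walk_copy.
- exact: lazy_walk_bridge.
- by rewrite bridge_at0 we.
Qed.

Lemma hunt0 c z : geodesic_choice -> hunt c z 0 = fun a => copy u0 a c.
Proof.
move=> geoP; apply/funext => a; case: z => //= i j ltij x _ _.
case: eqP => // ->; rewrite /hunter; have [_ w0 we] := geoP c x.
case: ifP => [_|]; first by rewrite w0.
by rewrite bridge_at0 -{2}w0 lt0n => /negbFE/eqP d0; rewrite we ?d0.
Qed.

Lemma hunt_step c z t a : geodesic_choice ->
  dist (hunt c z t a) (hunt c z t.+1 a) <= 1.
Proof.
move=> geoP; case: z => [k x|i j ltij x m hm] /=; first by rewrite distxx.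
case: ifP => _; last by rewrite distxx.
by rewrite -addn1 dist_lazy_walk //; apply: lazy_walk_hunter.
Qed.

Definition confined i j x q z : Prop :=
  exists2 m, q < m & bridge_coord z = Some (i, j, x, m).

(** The robber cannot slip past the hunter, whose position [q] on the bridge is
    to be read as [0] before he enters it: he is then within [rho] of the end
    [copy i x], as he started there and only came closer. The other end is
    within reach of the cop of copy [j], which stays put. *)
Lemma confined_edge c i j (ltij : i < j) x m (hm : 0 < m <= dist u0 x) t
    (z z' : T) :
    geodesic_choice -> dist c x <= rho ->
    edge z z' ->
    [forall a, rho < dist z' (hunt c (OnBridge ltij hm : T) t a)] ->
  confined i j x (t - dist c x) z -> confined i j x (t - dist c x) z'.
Proof.
set q := t - dist c x => geoP near /theta_edgeE zz' /forallP far [m0 ltq zE].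
have wl := lazy_walk_hunter c ltij x geoP.
have away_i : z' <> bridge_at u0 ltij x q.
  move=> ez; have := far i; rewrite /= eqxx ez ltnNge => /negP; apply.
  have [lt|le] := ltnP t (dist c x); last by rewrite /hunter ltnNge le distxx.
  have := dist_lazy_walk t (dist c x - t) wl; rewrite (subnKC (ltnW lt)).
  rewrite [hunter _ _ _ (dist c x)]/hunter ltnn subnn (dist_sym Tconn).
  by rewrite /q (_ : t - _ = 0); lia.
have away_j : z' <> copy u0 j x.
  move=> ez; have := far j; rewrite /= -val_eqE gtn_eqF // ez ltnNge.
  move/negP; apply; apply: leq_trans near; rewrite (dist_sym Gconn).
  exact: dist_copy.
case: zz' => zz'.
  case: _ _ / zz' zE away_i away_j => //=.
  - move=> i' j' lt x' m1 h1 h1' [ei ej ex em] _ _.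
    exists m0.+1; first exact: ltnW.
    by rewrite /= ei ej ex em.
  - by move=> i' j' lt x' m1 h1 _ [_ -> -> _] _.
case: _ _ / zz' zE away_i away_j => //=.
- move=> i' j' lt x' h1 [-> _ -> em] [].
  by rewrite (_ : q = 0) ?bridge_at0 //; lia.
- move=> i' j' lt x' m1 h1 h1' [ei ej ex em] away_i _.
  exists m1; last by rewrite /= ei ej ex.
  rewrite ltn_neqAle -ltnS em ltq andbT; apply/eqP => eq1; apply: away_i.
  rewrite -(@bridge_coordP _ _ _ i j ltij x q (OnBridge lt h1)) //=.
  by rewrite ei ej ex -eq1.
Qed.

End Trap.

Section Shadowing.
Variables (n : nat) (G : sgraph) (u0 : G) (Gconn : connected G).
Notation T := (Theta n u0).
Variables (rho : nat) (geo : G -> G -> nat -> G) (S : cop_strategy G 1).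

(** [Shadowing h] records the play of the single cop against the shadow;
    [Hunting c z t] says that the shadow was captured [t] moves ago from [c],
    the robber being at [z]. *)
Inductive cop_memory :=
| Shadowing (h : seq (cops G 1 * G))
| Hunting (c : G) (z : T) (t : nat).

Definition cop_update q z := match q with
  | Shadowing h =>
      let h' := rcons h (S h, shadow z) in
      if dist (shadow z) (S h' ord0) <= rho then Hunting (S h' ord0) z 0
      else Shadowing h'
  | Hunting c z0 t => Hunting c z0 t.+1
  end.

Definition cop_position q : cops T n := match q with
  | Shadowing h => fun a => copy u0 a (S h ord0)
  | Hunting c z t => hunt geo c z t
  end.

Definition shadow_strategy : cop_strategy T n :=
  memory_strategy (Shadowing [::]) cop_update cop_position.

Lemma memory_before (r : nat -> T) k (sr := fun j => shadow (r j)) :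
    (forall j, j < k -> ~ captured rho (play S sr) sr j) ->
  memory (Shadowing [::]) cop_update r k = Shadowing (history S sr k).
Proof.
elim: k => //= k IHk free; rewrite IHk /=; last first.
  by move=> j ltjk; apply: free; apply: ltnW.
rewrite ifN //; apply/negP => caught; apply: (free k) => //.
by exists ord0.
Qed.

Lemma memory_after (r : nat -> T) k t (sr := fun j => shadow (r j)) :
    (forall j, j < k -> ~ captured rho (play S sr) sr j) ->
    captured rho (play S sr) sr k ->
  memory (Shadowing [::]) cop_update r (k + t).+1 =
    Hunting (play S sr k.+1 ord0) (r k) t.
Proof.
move=> free [i]; rewrite (ord1 i) => caught.
elim: t => [|t IHt]; last by rewrite addnS /= -/(memory _ _ r (k + t).+1) IHt.
by rewrite addn0 /= memory_before //= ifT.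
Qed.

(** Here [A] stands for the robber, and [B] for his shadow, being out of reach of
    the cops. The shadow moves only while the robber walks inside a copy, where
    avoiding the mirrored cop means that the shadow avoids the original one. *)
Lemma shadow_path (A : pred T) (B : pred G) z p :
    (forall k x, A (copy u0 k x) -> B x) -> B (shadow z) ->
    path (@edge T) z p -> all A p ->
  exists p', [/\ is_path (shadow z) (shadow (last z p)) p', size p' <= size p &
    all B (shadow z :: p')].
Proof.
move=> AB; elim: p z => [|y p IHp] z Bz /=.
  by exists [::]; split; rewrite //= Bz.
case/andP=> zy yp /andP[Ay Ap].
have By : B (shadow y).
  by case: (edge_shadow zy) => [<-//|[k [_ ey _]]]; apply: (AB k); rewrite -ey.
have [p' [[yp' lp'] sp' Bp']] := IHp y By yp Ap.
case: (edge_shadow zy) => [ezy|[k [_ _ e]]].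
  by exists p'; rewrite ezy; split=> //; apply: leqW.
exists (shadow y :: p'); split=> //; last by rewrite /= Bz.
by split=> //=; rewrite e.
Qed.

Let Tconn : connected T := @Theta_connected n G u0 Gconn.

Lemma shadow_strategy_wins sigma psi (v : T) R :
    geodesic_choice geo -> 0 < sigma ->
    winning_strategy sigma rho psi (shadow v) R S ->
  winning_strategy sigma rho psi v R shadow_strategy.
Proof.
move=> geoP sigma_gt0 Swin c r cr rlegal.
have cE k := memory_strategyE k cr.
pose sr j := shadow (r j); pose sc := play S sr.
pose free k := forall j, j < k -> ~ captured rho sc sr j.
have c_before k : free k -> c k = fun a => copy u0 a (sc k ord0).
  by move=> fr; rewrite cE memory_before.
have c_after k t : free k -> captured rho sc sr k ->
    c (k + t).+1 = hunt geo (sc k.+1 ord0) (r k) t.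
  by move=> fr caught; rewrite cE memory_after.
(* The hunt starts from the mirrored position, so the capture of the shadow
   does not disturb the cops of that stage. *)
have c_mirror k : free k -> c k.+1 = fun a => copy u0 a (sc k.+1 ord0).
  move=> fr; have [caught|uncaught] := pselect (captured rho sc sr k).
    by rewrite -(addn0 k) c_after // addn0 hunt0.
  apply: c_before => j; rewrite ltnS leq_eqVlt => /predU1P[->//|].
  exact: fr.
have srlegal : robber_legal rho psi sc sr.
  move=> k uncaught.
  have fr : free k.+1 by move=> j; rewrite ltnS; apply: uncaught.
  have cE' j : j <= k -> c j.+1 = fun a => copy u0 a (sc j.+1 ord0).
    by move=> lejk; apply: c_before => i ltij; apply: fr; apply: leq_trans lejk.
  have [|p [[rp lp] sp]] := rlegal k.
    move=> j lejk [a]; rewrite cE' // => caught; apply: (uncaught j lejk).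
    exists ord0; apply: leq_trans caught.
    exact: (dist_shadow Gconn (r j) (copy u0 a _)).
  move=> /= /andP[_ pfree].
  have [||p' [ip' sp' p'free]] :=
    shadow_path (B := fun y => [forall i, rho < dist y (sc k.+1 i)])
      _ _ rp pfree.
  - move=> a x /forallP/(_ a); rewrite cE' // => far; apply/forallP => i.
    by rewrite (ord1 i); apply: leq_trans far (dist_copy _ Gconn _ _ _).
  - apply/forallP => i; rewrite ltnNge; apply/negP => caught.
    by apply: (uncaught k (leqnn k)); exists i.
  by exists p'; split=> //; [rewrite lp in ip' | apply: leq_trans sp].
have [sclegal scwin] := Swin sc sr (follows_play S sr) srlegal.
have first_capture k : captured rho sc sr k ->
    exists2 K, K <= k & free K /\ captured rho sc sr K.
  elim/ltn_ind: k => k IHk caught.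
  have [fr|] := pselect (free k); first by exists k.
  move=> /existsNP[j /not_implyP[ltjk /contrapT]] /(IHk j ltjk)[K leKj ?].
  by exists K => //; apply: leq_trans leKj (ltnW ltjk).
split.
  move=> k _ a; have [fr|] := pselect (free k).
    rewrite c_before // c_mirror //.
    exact: leq_trans (dist_copy _ Gconn _ _ _) (sclegal k fr ord0).
  move=> /existsNP[j /not_implyP[ltjk /contrapT]].
  move=> /first_capture[K leKj [fr caught]].
  have [t ek] : exists t, k = (K + t).+1 by exists (k - K.+1); lia.
  rewrite ek c_after // -addnS c_after //.
  exact: leq_trans (hunt_step _ _ _ _ geoP) sigma_gt0.
case: scwin => [[k /first_capture[K _ [fr caught]]]|[N N_gt0 far]]; last first.
  right; exists N => // k leNk; apply: leq_trans (far k leNk) _.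
  exact: dist_shadow.
left; apply: contrapT => /forallNP never.
have near : dist (sr K) (sc K.+1 ord0) <= rho.
  by case: caught => i; rewrite (ord1 i).
have [[b [x rK]]|[i [j [ltij [x [m [hm rK]]]]]]] :
    (exists b x, r K = copy u0 b x) \/ (exists (i j : 'I_n) (ltij : i < j) x m
      (hm : 0 < m <= dist u0 x), r K = OnBridge ltij hm).
  by case: (r K) => [b x|i j ltij x m hm]; [left | right]; repeat eexists.
  apply: (never K); exists b; rewrite c_mirror // rK.
  apply: leq_trans (dist_copy _ Gconn _ _ _) _.
  by move: near; rewrite /sr rK.
pose C := sc K.+1 ord0.
have nearC : dist C x <= rho by rewrite dist_sym //; move: near; rewrite /sr rK.
have cK t : c (K + t).+1 = hunt geo C (OnBridge ltij hm : T) t.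
  by rewrite c_after // rK.
(* The hunter gains one position per stage, until the bridge is exhausted. *)
have trapped t : confined i j x (t - dist C x) (r (K + t)).
  elim: t => [|t [q ltq rE]].
    by rewrite addn0 rK; exists m => //; have /andP[] := hm.
  have [|p [[rp lp] _ /= /andP[_ pfree]]] := rlegal (K + t).
    by move=> l _; apply: never.
  have [q' ltq' rE'] : confined i j x (t - dist C x) (r (K + t).+1).
    rewrite -lp; apply: (path_invariant _ _ rp pfree); last by exists q.
    by move=> y z yz; rewrite cK; apply: confined_edge.
  rewrite addnS; exists q' => //; rewrite ltnNge; apply/negP => leq'.
  apply: (never (K + t).+1); exists i.
  rewrite -addnS cK addnS /= eqxx /hunter.
  rewrite ltnNge (_ : dist C x <= t.+1) /=; last by lia.
  by rewrite (_ : t.+1 - _ = q') ?(bridge_coordP _ rE') ?distxx //; lia.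
have [q ltq] := trapped (dist C x + dist u0 x).
rewrite addKn in ltq; case: (r _) => //= i' j' _ x' m' hm' [_ _ ex em].
by move: hm'; rewrite ex em => /andP[_]; rewrite leqNgt ltq.
Qed.

End Shadowing.

Lemma Theta_CopWin n (G : sgraph) (u0 : G) sigma rho psi R :
    connected G -> 0 < sigma -> CopWin G 1 sigma rho psi R ->
  CopWin (Theta n u0) n sigma rho psi R.
Proof.
move=> Gconn sigma_gt0 Gwin v; have [S Swin] := Gwin (shadow v).
have /choice[geo geoP] := fun xy : G * G => lazy_geodesic Gconn xy.1 xy.2.
exists (@shadow_strategy n G u0 rho (fun x y => geo (x, y)) S).
by apply: shadow_strategy_wins => // x y; apply: (geoP (x, y)).
Qed.

(** * Fewer cops than copies fail *)

(** The pigeonhole principle behind both the free home and the free route. *)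
Lemma uncovered m n (P : 'I_m -> 'I_n -> Prop) : m < n ->
  (forall i a b, P i a -> P i b -> a = b) -> exists a, forall i, ~ P i a.
Proof.
move=> ltmn Pfun; apply: contrapT => none.
have /choice[g gP] : forall a, exists i, P i a.
  move=> a; apply: contrapT => noa; apply: none; exists a => i Pia.
  by apply: noa; exists i.
have /leq_card : injective g.
  by move=> a b eg; apply: (Pfun (g a)); rewrite // eg.
by rewrite !card_ord leqNgt ltmn.
Qed.

Section Routes.
Variables (n : nat) (G : sgraph) (u0 : G) (Gconn : connected G) (x0 : G).
Notation T := (Theta n u0).
Notation L := (dist u0 x0).
Notation home k := (copy u0 k x0).
Implicit Types (j k a b : 'I_n) (z : T).

Let Tconn : connected T := @Theta_connected n G u0 Gconn.

Lemma dist_homes (i j : 'I_n) : i != j -> L < dist (home i) (home j).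
Proof.
move=> neij; have := depth_lipschitz Gconn i (home i) (home j).
by rewrite /= eqxx eq_sym (negPf neij).
Qed.

(** The routes from the home of [k] to that of [j] are indexed by ['I_n]: the
    index [j] stands for the bridge over [x0], the index [k] for the descent to
    [u0], and any other index for the detour through the home of that copy.
    For each route but the descent, [route_depth] is a function of slow
    variation which vanishes on the other routes. The minimum serves the bridge
    from [k] to [j], since only bridges between [k] and [j] lie in both
    territories. Two distinct routes are not both the descent, so these
    functions separate any two routes. *)
Definition route_depth k j b z :=
  if b == j then minn (depth k z) (depth j z) else depth b z.

Lemma route_depth_lipschitz k j b z z' :
  route_depth k j b z <= route_depth k j b z' + dist z z'.
Proof.
have dk := depth_lipschitz Gconn k z z'.
have dj := depth_lipschitz Gconn j z z'.
by rewrite /route_depth; case: ifP => _; [lia | apply: depth_lipschitz].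
Qed.

(** On its own route, [route_depth] is so large that a point where it is small
    is close to one of the ends. *)
Lemma exists_route k j a : k != j -> exists w : nat -> T,
  [/\ lazy_walk w, w 0 = home k, forall t, L.+1.*2 <= t -> w t = home j &
    forall t,
      (a != k -> dist (w t) (home k) <= route_depth k j a (w t) \/
                 dist (w t) (home j) <= route_depth k j a (w t)) /\
      forall b, b != k -> b != a -> route_depth k j b (w t) = 0].
Proof.
move=> nekj; rewrite /route_depth.
have [->|neaj] := eqVneq a j.
  have [w [ww w0 we wd]] := exists_bridge u0 Gconn x0 nekj.
  exists w; split=> // [t ht|t]; first by apply: we; lia.
  have [dj dk d0] := wd t; split=> [_|b bk bj].
    by rewrite minnC minnE; lia.
  by rewrite (negPf bj) d0.
have [->|neak] := eqVneq a k.
  have [w [ww w0 we]] := lazy_geodesic Gconn x0 u0.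
  have eL : dist x0 u0 = L by rewrite dist_sym.
  exists (fun t => if t < L.+1 then copy u0 k (w t)
                   else copy u0 j (w (L - (t - L.+1)))); split.
  - move=> t; case: (ltngtP t L) => ht.
    + by rewrite !ltnS ht (ltnW ht); apply: (lazy_walk_copy u0 k ww).
    + rewrite !(ltnNge _ L.+1) ht (leqW ht) /= subSn //.
      exact: (lazy_walk_rev L (lazy_walk_copy u0 j ww)).
    + right; rewrite ht ltnSn ltnn subnn subn0 we ?eL //.
      exact: edge_centre.
  - by rewrite /= w0.
  - move=> t ht; rewrite ltnNge (_ : L < t) /=; last by lia.
    by rewrite (_ : L - _ = 0) ?w0 //; lia.
  - move=> t; split=> // b bk _.
    have [_|bj] := eqVneq b j.
      by case: ifP => _ /=; rewrite ?(eq_sym j k) (negPf nekj) ?minn0 ?min0n.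
    by case: ifP => _ /=; rewrite eq_sym ?(negPf bk) ?(negPf bj).
have neka : k != a by rewrite eq_sym.
have [w1 [ww1 w10 w1e wd1]] := exists_bridge u0 Gconn x0 neka.
have [w2 [ww2 w20 w2e wd2]] := exists_bridge u0 Gconn x0 neaj.
exists (fun t => if t < L.+1 then w1 t else w2 (t - L.+1)); split=> [||t ht|t].
- by apply: lazy_walk_cat; rewrite // w1e.
- by rewrite /= w10.
- by rewrite ltnNge (_ : L < t) /= ?w2e //; lia.
- case: ifP => _.
    have [da dk d0] := wd1 t; split=> [_|b bk ba]; first by left.
    have [_|bj] := eqVneq b j; last exact: d0.
    by rewrite (d0 j) ?minn0 // eq_sym.
  have [dj da d0] := wd2 (t - L.+1); split=> [_|b bk ba]; first by right.
  have [_|bj] := eqVneq b j; last exact: d0.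
  by rewrite (d0 k) ?min0n.
Qed.

(** A cop within [d] of two routes witnesses two points of distinct routes at
    distance at most [2 * d]. By [exists_route] one of these is within [2 * d]
    of an end, so the cop is within [3 * d] of it. *)
Lemma exists_free_route m (c : cops T m) k j d :
    m < n -> k != j ->
    (forall i, 3 * d < dist (c i) (home k)) ->
    (forall i, 3 * d < dist (c i) (home j)) ->
  exists w : nat -> T,
    [/\ lazy_walk w, w 0 = home k, forall t, L.+1.*2 <= t -> w t = home j &
      forall i t, d < dist (c i) (w t)].
Proof.
move=> ltmn nekj fark farj.
have /choice[w wP] := fun a => exists_route a nekj.
have [|a afree] := @uncovered m n
  (fun i a => exists t, dist (c i) (w a t) <= d) ltmn; last first.
  have [ww w0 we _] := wP a; exists (w a); split=> // i t.
  by rewrite ltnNge; apply/negP => le; apply: (afree i); exists t.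
have half a b i s t : a != k -> b != a ->
    dist (c i) (w a s) <= d -> dist (c i) (w b t) <= d -> False.
  move=> ak ba da db.
  have [_ _ _ /(_ s)[/(_ ak) near _]] := wP a.
  have [_ _ _ /(_ t)[_ /(_ a ak)zero]] := wP b.
  have := route_depth_lipschitz k j a (w a s) (w b t).
  rewrite zero 1?eq_sym // add0n => le.
  have := dist_triangle Tconn (w a s) (c i) (w b t).
  rewrite (dist_sym Tconn (w a s) (c i)) => le'.
  have := fark i; have := farj i.
  have := dist_triangle Tconn (c i) (w a s) (home k).
  have := dist_triangle Tconn (c i) (w a s) (home j).
  by case: near => near; lia.
move=> i a b [s da] [t db]; apply/eqP; apply: contraT => neab.
have [ak|ak] := eqVneq a k.
  by case: (half b a i t s) => //; rewrite -ak eq_sym.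
by case: (half a b i s t) => //; rewrite eq_sym.
Qed.

(** The robber rests at home until a cop comes within [D]; a flight takes
    [N.+1] stages. While fleeing he is safe from cops which are initially more
    than [rho + sigma * N.+1] away from his route, and three times this
    distance, plus one cop move made before he notices, is what
    [exists_free_route] requires of [D]. The last bound on [D] makes the
    [(D + sigma * N.+1)]-balls around the homes disjoint. *)
Lemma few_cops_lose m sigma rho psi N D R v :
    m < n -> L.+1.*2 <= N.+1 * psi ->
    3 * (rho + sigma * N.+1) + sigma <= D ->
    2 * (D + sigma * N.+1) <= L ->
    (forall k, dist v (home k) + N.+1 * psi <= R) ->
  forall S : cop_strategy T m, ~ winning_strategy sigma rho psi v R S.
Proof.
move=> ltmn lenN leD leL leR.
(* [w] is the rest of a flight to the home of [j] which ends after [t] stages,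
   and the cops do not interfere within their next [e] moves. *)
pose plan t e (c : cops T m) z := exists w j, [/\ lazy_walk w, w 0 = z,
  forall s, t * psi <= s -> w s = home j,
  forall s, dist v (w s) <= R &
  forall i, D + sigma * e < dist (c i) (home j) /\
    forall s, rho + sigma * e < dist (c i) (w s)].
have free_home (c : cops T m) :
    exists j, forall i, D + sigma * N.+1 < dist (c i) (home j).
  have [|j jfree] := @uncovered m n
    (fun i j => dist (c i) (home j) <= D + sigma * N.+1) ltmn.
    move=> i a b da db; apply/eqP; apply: contraT => /dist_homes.
    have := dist_triangle Tconn (home a) (c i) (home b).
    by rewrite (dist_sym Tconn (home a) (c i)); lia.
  by exists j => i; rewrite ltnNge; apply/negP/jfree.
have rest c j : (forall i, D < dist (c i) (home j)) -> plan 0 0 c (home j).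
  move=> far; exists (fun=> home j), j; split=> //.
  - by move=> t; left.
  - by move=> s; apply: leq_trans (leR j); apply: leq_addr.
  - move=> i; rewrite muln0 !addn0; split=> // s.
    by apply: leq_ltn_trans (far i); lia.
(* One stage of a plan, the cops having already moved to [c]. *)
have advance t c z : plan t.+1 t c z ->
    exists z', robber_move rho psi c z z' /\ plan t t c z'.
  move=> [w [j [ww w0 we wR far]]]; exists (w psi); split.
    have [p [wp sp pA]] := path_of_lazy_walk 0 psi ww.
    exists p; rewrite -w0; split=> //.
    apply: pA => s; apply/forallP => i; have [_ /(_ s)] := far i.
    by rewrite (dist_sym Tconn); lia.
  exists (fun s => w (psi + s)), j; split=> //.
  - exact: lazy_walk_shift.
  - by rewrite addn0.
  - by move=> s hs; apply: we; rewrite mulSn leq_add2l.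
  - by move=> i; have [fj fw] := far i.
apply: (robber_evades (I := fun c z => exists t, plan t t c z)).
- move=> c; have [j far] := free_home c; exists (home j), 0; apply: rest => i.
  by apply: leq_ltn_trans (far i); apply: leq_addr.
- by move=> c z [t [w [j [_ <- _ wR _]]]].
move=> c z c' [t [w [j [ww w0 we wR far]]]] cc'.
have slow i y : dist (c i) y <= sigma + dist (c' i) y.
  by have := dist_triangle Tconn (c i) (c' i) y; have := cc' i; lia.
case: t we far => [|t] we far.
  have ez : z = home j by rewrite -w0 we.
  have far' i : 3 * (rho + sigma * N.+1) < dist (c' i) (home j).
    by have [+ _] := far i; have := slow i (home j); lia.
  split=> [i|].
    by rewrite ez (dist_sym Tconn); have := far' i; lia.
  have [far0|near] := pselect (forall i, D < dist (c' i) (home j)).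
    exists z; rewrite ez; split; last by exists 0; apply: rest.
    exists [::]; split=> //=; rewrite andbT; apply/forallP => i.
    by rewrite (dist_sym Tconn); have := far' i; lia.
  have [k fark] := free_home c'.
  (* The cop which disturbs the robber is too close to [j] for [k] to be [j]. *)
  have nejk : j != k.
    apply/eqP => ejk; apply: near => i; rewrite ejk.
    by apply: leq_ltn_trans (fark i); apply: leq_addr.
  have [|w' [ww' w0' we' wfar]] := exists_free_route ltmn nejk far'.
    by move=> i; have := fark i; lia.
  have [|z' [move_z plan_z]] := @advance N c' (home j).
    exists w', k; split=> // [s hs|s|i].
    - by apply: we'; apply: leq_trans hs.
    - apply: leq_trans (leR j).
      apply: leq_trans (dist_triangle Tconn v (home j) (w' s)) _.
      rewrite leq_add2l -w0'.
      have [le|lt] := leqP s (N.+1 * psi).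
        by apply: leq_trans le; have := dist_lazy_walk 0 s ww'.
      rewrite (we' s); last exact: leq_trans lenN (ltnW lt).
      rewrite -(we' _ lenN); exact: (dist_lazy_walk 0 (N.+1 * psi) ww').
    - split=> [|s]; first by have := fark i; lia.
      by have := wfar i s; lia.
  by exists z'; rewrite ez; split=> //; exists N.
have far' i : D + sigma * t < dist (c' i) (home j) /\
    forall s, rho + sigma * t < dist (c' i) (w s).
  have [fj fw] := far i; split=> [|s]; first by have := slow i (home j); lia.
  by have := fw s; have := slow i (w s); lia.
split=> [i|].
  by rewrite -w0 (dist_sym Tconn); have [_ /(_ 0)] := far' i; lia.
have [|z' [move_z plan_z]] := @advance t c' z; first by exists w, j.
by exists z'; split=> //; exists t.
Qed.

End Routes.

Lemma Theta_not_strong_cop_win n (G : sgraph) (u0 : G) m :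
    connected G -> unbounded G -> m < n ->
  ~ strong_cop_win (Theta n u0) m.
Proof.
move=> Gconn Gunb ltmn [sigma sigma_gt0 win].
(* With this speed the cops move by at most about [L / 16] during a flight,
   and [12 * rho + 20 * sigma] absorbs the remaining terms of the inequality
   [2 * (D + sigma * N.+1) <= L], where [D] itself contains [3 * rho] and
   three times the cops' displacement. *)
pose psi := 32 * sigma.
have [|rho {}win] := win psi; first by rewrite muln_gt0.
have [x0 farx0] : exists x0, 12 * rho + 20 * sigma <= dist u0 x0.
  have [x [y xy]] := Gunb (24 * rho + 40 * sigma).
  have := dist_triangle Gconn x u0 y; rewrite (dist_sym Gconn x u0).
  have [le|lt] := leqP (12 * rho + 20 * sigma) (dist u0 x); first by exists x.
  by exists y; lia.
pose L := dist u0 x0; pose N := (L.+1.*2) %/ psi.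
have lenN : L.+1.*2 <= N.+1 * psi by apply/ltnW/ltn_ceil; rewrite muln_gt0.
have leN : sigma * N * 32 <= L.+1.*2.
  by rewrite mulnAC mulnC -(mulnC 32) leq_trunc_div.
have v : Theta n u0 := copy u0 (Ordinal (leq_ltn_trans (leq0n m) ltmn)) x0.
pose D := 3 * (rho + sigma * N.+1) + sigma.
pose R := (\max_k dist v (copy u0 k x0) + N.+1 * psi).+1.
have [|S Swin] := win R _ v; first by [].
apply: (@few_cops_lose n G u0 Gconn x0 m sigma rho psi N D R v) Swin => //.
- by move: farx0 leN; rewrite /D -/L mulnS; lia.
- move=> k; rewrite /R ltnW // ltnS leq_add2r.
  exact: (leq_bigmax_cond (F := fun k => dist v (copy u0 k x0))).
Qed.

(** * The cop numbers *)

Theorem theorem14 (G : sgraph) (u0 : G) (n : nat) (Gconn : connected G)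
    (Gunb : unbounded G) (n_gt0 : 0 < n) :
  (wCop G = Some 1 -> wCop (Theta n u0) = Some n) /\
  (sCop G = Some 1 -> sCop (Theta n u0) = Some n).
Proof.
have lower m : 0 < m < n -> ~ strong_cop_win (Theta n u0) m.
  by case/andP=> _; apply: Theta_not_strong_cop_win.
split=> /least_positiveP-/(_ isT)[+ _].
- move=> [sigma sigma_gt0 [rho win]]; apply/least_positiveP => //; split.
    exists sigma => //; exists rho => psi R psi_gt0 R_gt0.
    by apply: Theta_CopWin => //; apply: win.
  by move=> m /lower notwin /weak_strong_cop_win.
- move=> [sigma sigma_gt0 win]; apply/least_positiveP => //.
  split; last exact: lower.
  exists sigma => // psi psi_gt0; have [rho {}win] := win psi psi_gt0.
  by exists rho => R R_gt0; apply: Theta_CopWin => //; apply: win.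
Qed.
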